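(* Let $(H,\mu,\Delta,\alpha,c,R)$ be a quasi-triangular Hom-bialgebra over $\mathbf{k}$. (1) Then $H^n = (H,\mu^{(n)},\Delta^{(n)},\alpha^{2^n},c,R)$ is a quasi-triangular Hom-bialgebra for each integer $n \geq 0$, where $\mu^{(n)} = \alpha^{2^n-1}\circ\mu$ and $\Delta^{(n)} = \Delta \circ \alpha^{2^n-1}$. (2) If $\alpha$ is surjective, then $H^{n,k} = (H,\mu^{(n)},\Delta^{(n)},\alpha^{2^n},c,R^{\alpha^k})$ is a quasi-triangular Hom-bialgebra for each pair of integers $n,k \geq 0$, where $R^{\alpha^k} = (\alpha^{k} \otimes \alpha^{k})(R)$.
   Context: $\mathbf{k}$ is a fixed associative and commutative ring of characteristic $0$; modules, tensor products and linear maps are over $\mathbf{k}$. For a self-map $\alpha$, $\alpha^n$ is the $n$-fold composition, $\alpha^0 = Id$. $\tau(v\otimes w)=w\otimes v$ is the twist isomorphism. Multiplication $\mu(x,y)$ is written $xy$; $\Delta(x)=\sum x_1\otimes x_2$ is Sweedler's notation. A Hom-associative algebra $(A,\mu,\alpha)$ is a $\mathbf{k}$-module $A$ with linear maps $\mu\colon A^{\otimes 2}\to A$, $\alpha\colon A\to A$ such that $\alpha\circ\mu=\mu\circ\alpha^{\otimes 2}$ and $\mu\circ(\alpha\otimes\mu)=\mu\circ(\mu\otimes\alpha)$. A Hom-coassociative coalgebra $(C,\Delta,\alpha)$ is a $\mathbf{k}$-module $C$ with linear maps $\Delta\colon C\to C^{\otimes 2}$, $\alpha\colon C\to C$ such that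 $\alpha^{\otimes 2}\circ\Delta=\Delta\circ\alpha$ and $(\alpha\otimes\Delta)\circ\Delta=(\Delta\otimes\alpha)\circ\Delta$. A Hom-bialgebra $(H,\mu,\Delta,\alpha)$ is such that $(H,\mu,\alpha)$ is a Hom-associative algebra, $(H,\Delta,\alpha)$ is a Hom-coassociative coalgebra, and $\Delta\circ\mu=\mu^{\otimes 2}\circ(Id\otimes\tau\otimes Id)\circ\Delta^{\otimes 2}$. A weak unit of a Hom-associative algebra $(A,\mu,\alpha)$ is an element $c\in A$ with $\alpha(x)=cx=xc$ for all $x\in A$. For $R\in A^{\otimes 2}$ define in $A^{\otimes 3}$: $R_{12}=R\otimes c$, $R_{23}=c\otimes R$, $R_{13}=(\tau\otimes Id)(R_{23})$. A quasi-triangular Hom-bialgebra is a tuple $(H,\mu,\Delta,\alpha,c,R)$ in which $(H,\mu,\Delta,\alpha)$ is a Hom-bialgebra, $c$ is a weak unit of $(H,\mu,\alpha)$, and $R\in H^{\otimes 2}$ satisfies $(\Delta\otimes\alpha)(R)=R_{13}R_{23}$, $(\alpha\otimes\Delta)(R)=R_{13}R_{12}$, and $[\Delta^{op}(x)]R=R\Delta(x)$ for all $x\in H$, where $\Delta^{op}=\tau\circ\Delta$ and multiplication is done in each tensor factor. Explicitly, with $R=\sum s_i\otimes t_i$, $\Delta(s_i)=\sum s_i'\otimes s_i''$, $\Delta(t_i)=\sum t_i'\otimes t_i''$, these say: $\sum s_i'\otimes s_i''\otimes\alpha(t_i)=\sum\alpha(s_i)\otimes\alpha(s_j)\otimes t_it_j$;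 $\sum\alpha(s_i)\otimes t_i'\otimes t_i''=\sum s_js_i\otimes\alpha(t_i)\otimes\alpha(t_j)$; $\sum x_2s_i\otimes x_1t_i=\sum s_ix_1\otimes t_ix_2$. *)

(* Defs.v *)
From HB Require Import structures.
From mathcomp Require Import all_boot all_algebra generic_quotient.
From mathcomp Require Import boolp.
From mathcomp.multinomials Require Import freeg.

Set Implicit Arguments.
Unset Strict Implicit.
Unset Printing Implicit Defensive.

Import GRing.Theory.

Local Open Scope ring_scope.
Local Open Scope quotient_scope.

(* MathComp has no tensor product of modules over a commutative ring. It is
   packaged here with its universal property; tp_ind (generation by pure
   tensors) gives the uniqueness of tp_lift. *)
Structure tensor_product (K : comNzRingType) (U V : lmodType K) :=
  TensorProduct {
  tp_mod : lmodType K;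
  tp_tens : {bilinear U -> V -> tp_mod};
  tp_ind : forall P : tp_mod -> Prop,
    P 0 -> (forall u v, P (tp_tens u v)) ->
    (forall s t, P s -> P t -> P (s + t)) ->
    (forall a t, P t -> P (a *: t)) ->
    forall t, P t;
  tp_lift : forall W : lmodType K,
    {bilinear U -> V -> W} -> {linear tp_mod -> W};
  tp_liftE : forall (W : lmodType K) (f : {bilinear U -> V -> W}) u v,
    tp_lift f (tp_tens u v) = f u v
}.

(* The quotient of the free module on U * V by the submodule generated by the
   bilinearity relations. *)
Section TensorQuotient.
Variables (K : comNzRingType) (U V : lmodType K).

Notation FreeUV := {freeg (U * V)%type / K}.

Definition fgen (u : U) (v : V) : FreeUV := Freeg [:: (1, (u, v))].

Inductive tensor_null : FreeUV -> Prop :=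
| TensorNullL a u u' v :
    tensor_null (fgen (a *: u + u') v - (a *: fgen u v + fgen u' v))
| TensorNullR a u v v' :
    tensor_null (fgen u (a *: v + v') - (a *: fgen u v + fgen u v'))
| TensorNull0 : tensor_null 0
| TensorNullD x y : tensor_null x -> tensor_null y -> tensor_null (x + y)
| TensorNullZ a x : tensor_null x -> tensor_null (a *: x).

Definition tensor_nullb : {pred FreeUV} := fun x => `[< tensor_null x >].

Lemma tensor_nullP x : reflect (tensor_null x) (x \in tensor_nullb).
Proof. exact: asboolP. Qed.

Lemma tensor_null_zmod_closed : zmod_closed tensor_nullb.
Proof.
split=> [|x y /tensor_nullP xN /tensor_nullP yN]; apply/tensor_nullP.
  exact: TensorNull0.
by apply: TensorNullD => //; rewrite -scaleN1r; apply: TensorNullZ.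
Qed.

HB.instance Definition _ :=
  GRing.isZmodClosed.Build FreeUV tensor_nullb tensor_null_zmod_closed.

Local Notation quotN := (Quotient.quot tensor_nullb).

Definition tensor_quot : Type := quotN.

HB.instance Definition _ := GRing.Zmodule.on tensor_quot.
HB.instance Definition _ := Quotient.on tensor_quot.

Definition tensor_pi (x : FreeUV) : tensor_quot := \pi_quotN x.

Lemma tensor_pi_eqP x y :
  reflect (tensor_pi x = tensor_pi y) (x - y \in tensor_nullb).
Proof. by rewrite Quotient.idealrBE; apply: eqP. Qed.

Lemma tensor_piD x y : tensor_pi (x + y) = tensor_pi x + tensor_pi y.
Proof. exact: (raddfD (\pi_quotN)). Qed.

Lemma tensor_pi0 : tensor_pi 0 = 0.
Proof. exact: (raddf0 (\pi_quotN)). Qed.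

Definition tensor_scale (a : K) (t : tensor_quot) : tensor_quot :=
  tensor_pi (a *: repr t).

Lemma tensor_pi_scale a x : tensor_scale a (tensor_pi x) = tensor_pi (a *: x).
Proof.
apply/tensor_pi_eqP; rewrite -scalerBr.
apply/tensor_nullP/TensorNullZ/tensor_nullP.
by apply/tensor_pi_eqP; rewrite /tensor_pi reprK.
Qed.

Lemma tensor_piW (P : tensor_quot -> Prop) :
  (forall x, P (tensor_pi x)) -> forall t, P t.
Proof. by move=> Ppi t; rewrite -[t]reprK; apply: Ppi. Qed.

Lemma tensor_scaleA a b t :
  tensor_scale a (tensor_scale b t) = tensor_scale (a * b) t.
Proof. by elim/tensor_piW: t => x; rewrite !tensor_pi_scale scalerA. Qed.

Lemma tensor_scale1 : left_id 1 tensor_scale.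
Proof. by elim/tensor_piW => x; rewrite tensor_pi_scale scale1r. Qed.

Lemma tensor_scaleDr : right_distributive tensor_scale +%R.
Proof.
move=> a; elim/tensor_piW => x; elim/tensor_piW => y.
by rewrite -tensor_piD !tensor_pi_scale scalerDr tensor_piD.
Qed.

Lemma tensor_scaleDl t : {morph tensor_scale^~ t : a b / a + b}.
Proof.
by elim/tensor_piW: t => x a b; rewrite !tensor_pi_scale scalerDl tensor_piD.
Qed.

HB.instance Definition _ := GRing.Zmodule_isLmodule.Build K tensor_quot
  tensor_scaleA tensor_scale1 tensor_scaleDr tensor_scaleDl.

Lemma tensor_piZ a x : tensor_pi (a *: x) = a *: tensor_pi x.
Proof. by rewrite -tensor_pi_scale. Qed.

Definition quot_tens (u : U) (v : V) : tensor_quot := tensor_pi (fgen u v).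

Lemma quot_tens_bilinear : bilinear_for *:%R *:%R quot_tens.
Proof.
split=> [v a u u'|u a v v'] /=; rewrite /quot_tens -tensor_piZ -tensor_piD;
  apply/tensor_pi_eqP/tensor_nullP; [exact: TensorNullL|exact: TensorNullR].
Qed.

HB.instance Definition _ := bilinear_isBilinear.Build K U V tensor_quot
  *:%R *:%R quot_tens quot_tens_bilinear.

Lemma scale_freegU a b p :
  a *: Freeg [:: (b, p)] = Freeg [:: (a * b, p)] :> FreeUV.
Proof. by apply/eqP/freeg_eqP => q; rewrite coeffZ !coeffU mulrA. Qed.

Lemma tensor_quot_ind (P : tensor_quot -> Prop) :
    P 0 -> (forall u v, P (quot_tens u v)) ->
    (forall s t, P s -> P t -> P (s + t)) ->
    (forall a t, P t -> P (a *: t)) ->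
  forall t, P t.
Proof.
move=> P0 Pt PD PZ; elim/tensor_piW => x; rewrite -[x]freeg_sumE.
elim: (dom x) => [|[u v] s IHs]; first by rewrite big_nil tensor_pi0.
rewrite big_cons tensor_piD -[coeff _ _]mulr1 -scale_freegU tensor_piZ.
by apply: PD => //; apply: PZ (Pt _ _).
Qed.

Section Lift.
Variables (W : lmodType K) (f : {bilinear U -> V -> W}).

Definition flift (x : FreeUV) : W := fglift (fun p : U * V => f p.1 p.2) x.

HB.instance Definition _ :=
  GRing.isZmodMorphism.Build FreeUV W flift (lift_is_additive _).

Lemma flift_scalable : scalable flift.
Proof.
move=> a x; rewrite -[x]freeg_sumE scaler_sumr !raddf_sum.
by apply: eq_bigr => p _; rewrite scale_freegU /= /flift !liftU scalerA.
Qed.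

HB.instance Definition _ :=
  GRing.isScalable.Build K FreeUV W *:%R flift flift_scalable.

Lemma flift_gen u v : flift (fgen u v) = f u v.
Proof. by rewrite /flift /fgen liftU scale1r. Qed.

Lemma flift_null x : tensor_null x -> flift x = 0.
Proof.
elim=> {x} [a u u' v|a u v v'||x y _ x0 _ y0|a x _ x0].
- by rewrite raddfB /= linearP /= !flift_gen linearPl subrr.
- by rewrite raddfB /= linearP /= !flift_gen linearPr subrr.
- exact: raddf0.
- by rewrite raddfD /= x0 y0 addr0.
- by rewrite linearZ /= x0 scaler0.
Qed.

Definition quot_lift (t : tensor_quot) : W := flift (repr t).

Lemma quot_lift_pi x : quot_lift (tensor_pi x) = flift x.
Proof.
apply/eqP; rewrite -subr_eq0 -raddfB.
apply/eqP/flift_null/tensor_nullP/tensor_pi_eqP.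
by rewrite /tensor_pi reprK.
Qed.

Lemma quot_liftE u v : quot_lift (quot_tens u v) = f u v.
Proof. by rewrite quot_lift_pi flift_gen. Qed.

Lemma quot_lift_linear : linear quot_lift.
Proof.
move=> a; elim/tensor_piW => x; elim/tensor_piW => y.
by rewrite -tensor_piZ -tensor_piD !quot_lift_pi linearP.
Qed.

HB.instance Definition _ := GRing.isLinear.Build K tensor_quot W *:%R quot_lift
  quot_lift_linear.

End Lift.
End TensorQuotient.

(* Locked, so that unification never unfolds the construction. *)
Fact tensor_key : unit. Proof. by []. Qed.
Definition tensor_tp (K : comNzRingType) (U V : lmodType K) :
    tensor_product U V :=
  locked_with tensor_key (@TensorProduct K U V _ (@quot_tens K U V)
    (@tensor_quot_ind K U V) (@quot_lift K U V) (@quot_liftE K U V)).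

Definition tensor (K : comNzRingType) (U V : lmodType K) : lmodType K :=
  tp_mod (tensor_tp U V).

Definition tens (K : comNzRingType) (U V : lmodType K) :
    {bilinear U -> V -> tensor U V} :=
  tp_tens (tensor_tp U V).

Definition tlift (K : comNzRingType) (U V W : lmodType K)
    (f : {bilinear U -> V -> W}) : {linear tensor U V -> W} :=
  tp_lift (tensor_tp U V) f.

Arguments tens {K U V}.

Notation "U ⊗ V" := (tensor U V)
  (at level 40, left associativity).
Notation "u ⊗ₜ v" := (tens u v)
  (at level 40, left associativity) : ring_scope.

Section TensorTheory.
Variables (K : comNzRingType) (U V : lmodType K).

Lemma tensor_ind (P : U ⊗ V -> Prop) :
    P 0 -> (forall u v, P (u ⊗ₜ v)) ->
    (forall s t, P s -> P t -> P (s + t)) ->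
    (forall a t, P t -> P (a *: t)) ->
  forall t, P t.
Proof. exact: tp_ind. Qed.

Lemma tliftE (W : lmodType K) (f : {bilinear U -> V -> W}) u v :
  tlift f (u ⊗ₜ v) = f u v.
Proof. exact: tp_liftE. Qed.

Lemma eq_tensor (W : lmodType K) (f g : {linear U ⊗ V -> W}) :
  (forall u v, f (u ⊗ₜ v) = g (u ⊗ₜ v)) -> f =1 g.
Proof.
move=> fg; apply: tensor_ind => [|//|s t fs ft|a t ft].
- by rewrite !linear0.
- by rewrite !linearD fs ft.
- by rewrite !linearZ /= ft.
Qed.

End TensorTheory.

Section TensorMap.
Variables (K : comNzRingType) (U U' V V' : lmodType K).
Variables (f : {linear U -> U'}) (g : {linear V -> V'}).

Let tmap0 (u : U) (v : V) : U' ⊗ V' := f u ⊗ₜ g v.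

Let tmap0_bilinear : bilinear_for *:%R *:%R tmap0.
Proof.
by split=> [v a u u'|u a v v']; rewrite /tmap0 /= linearP ?linearPl ?linearPr.
Qed.

HB.instance Definition _ :=
  bilinear_isBilinear.Build K U V (U' ⊗ V') *:%R *:%R tmap0 tmap0_bilinear.

Definition tmap : {linear U ⊗ V -> U' ⊗ V'} := tlift tmap0.

Lemma tmapE u v : tmap (u ⊗ₜ v) = f u ⊗ₜ g v.
Proof. exact: tliftE. Qed.

End TensorMap.

Section Twist.
Variables (K : comNzRingType) (U V : lmodType K).

Let twist0 (u : U) (v : V) : V ⊗ U := v ⊗ₜ u.

Let twist0_bilinear : bilinear_for *:%R *:%R twist0.
Proof.
by split=> [v a u u'|u a v v']; rewrite /twist0 /= ?linearPl ?linearPr.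
Qed.

HB.instance Definition _ :=
  bilinear_isBilinear.Build K U V (V ⊗ U) *:%R *:%R twist0 twist0_bilinear.

Definition twist : {linear U ⊗ V -> V ⊗ U} := tlift twist0.

Lemma twistE u v : twist (u ⊗ₜ v) = v ⊗ₜ u.
Proof. exact: tliftE. Qed.

End Twist.

Arguments twist {K U V}.

(* The canonical isomorphism U ⊗ (V ⊗ W) -> (U ⊗ V) ⊗ W and its inverse;
   threefold tensor powers are represented left-associated. *)
Section Associator.
Variables (K : comNzRingType) (U V W : lmodType K).

Section AssocLeft.
Variable u : U.

Let assoc0 (v : V) (w : W) : U ⊗ V ⊗ W := u ⊗ₜ v ⊗ₜ w.

Let assoc0_bilinear : bilinear_for *:%R *:%R assoc0.
Proof.
by split=> [w a v v'|v a w w'];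
  rewrite /assoc0 /= ?linearPr ?linearPl ?linearPr.
Qed.

HB.instance Definition _ := bilinear_isBilinear.Build K V W (U ⊗ V ⊗ W)
  *:%R *:%R assoc0 assoc0_bilinear.

Definition tassoc1 : {linear V ⊗ W -> U ⊗ V ⊗ W} := tlift assoc0.

Lemma tassoc1E v w : tassoc1 (v ⊗ₜ w) = u ⊗ₜ v ⊗ₜ w.
Proof. exact: tliftE. Qed.

End AssocLeft.

Let assoc2 (u : U) (t : V ⊗ W) : U ⊗ V ⊗ W := tassoc1 u t.

Let assoc2_bilinear : bilinear_for *:%R *:%R assoc2.
Proof.
split=> [t a u u'|u a t t'] /=; rewrite /assoc2 /=; last by rewrite linearP.
elim/tensor_ind: t => [|v w|s t IHs IHt|b t IHt].
- by rewrite !linear0 addr0.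
- by rewrite !tassoc1E linearPl /= linearPl.
- by rewrite !linearD /= IHs IHt addrACA.
- by rewrite !linearZ /= IHt scalerDr !scalerA mulrC.
Qed.

HB.instance Definition _ := bilinear_isBilinear.Build K U (V ⊗ W)
  (U ⊗ V ⊗ W) *:%R *:%R assoc2 assoc2_bilinear.

Definition tassoc : {linear U ⊗ (V ⊗ W) -> U ⊗ V ⊗ W} := tlift assoc2.

Lemma tassocE u v w : tassoc (u ⊗ₜ (v ⊗ₜ w)) = u ⊗ₜ v ⊗ₜ w.
Proof. by rewrite /tassoc tliftE /= /assoc2 tassoc1E. Qed.

Section AssocRight.
Variable w : W.

Let assocV0 (u : U) (v : V) : U ⊗ (V ⊗ W) := u ⊗ₜ (v ⊗ₜ w).

Let assocV0_bilinear : bilinear_for *:%R *:%R assocV0.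
Proof.
by split=> [v a u u'|u a v v']; rewrite /assocV0 /= ?linearPl ?linearPr.
Qed.

HB.instance Definition _ := bilinear_isBilinear.Build K U V (U ⊗ (V ⊗ W))
  *:%R *:%R assocV0 assocV0_bilinear.

Definition tassocV1 : {linear U ⊗ V -> U ⊗ (V ⊗ W)} := tlift assocV0.

Lemma tassocV1E u v : tassocV1 (u ⊗ₜ v) = u ⊗ₜ (v ⊗ₜ w).
Proof. exact: tliftE. Qed.

End AssocRight.

Let assocV2 (t : U ⊗ V) (w : W) : U ⊗ (V ⊗ W) := tassocV1 w t.

Let assocV2_bilinear : bilinear_for *:%R *:%R assocV2.
Proof.
split=> [w a t t'|t a w w'] /=; rewrite /assocV2 /=; first by rewrite linearP.
elim/tensor_ind: t => [|u v|s t IHs IHt|b t IHt].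
- by rewrite !linear0 addr0.
- by rewrite !tassocV1E linearPr /= linearPr.
- by rewrite !linearD /= IHs IHt addrACA.
- by rewrite !linearZ /= IHt scalerDr !scalerA mulrC.
Qed.

HB.instance Definition _ := bilinear_isBilinear.Build K (U ⊗ V) W
  (U ⊗ (V ⊗ W)) *:%R *:%R assocV2 assocV2_bilinear.

Definition tassocV : {linear U ⊗ V ⊗ W -> U ⊗ (V ⊗ W)} := tlift assocV2.

Lemma tassocVE u v w : tassocV (u ⊗ₜ v ⊗ₜ w) = u ⊗ₜ (v ⊗ₜ w).
Proof. by rewrite /tassocV tliftE /= /assocV2 /= tassocV1E. Qed.

End Associator.

Arguments tassoc {K U V W}.
Arguments tassocV {K U V W}.

Section Iteration.
Variables (K : comNzRingType) (U : lmodType K) (f : {linear U -> U}) (n : nat).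

Lemma iter_linear : linear (iter n f).
Proof. by move=> a u v; elim: n => //= m ->; rewrite linearP. Qed.

HB.instance Definition _ := GRing.isLinear.Build K U U *:%R (iter n f)
  iter_linear.

End Iteration.

Section TensorAlgebra.
Variables (K : comNzRingType) (U V : lmodType K).

(* Id ⊗ twist ⊗ Id, up to the associators *)
Definition tswap : (U ⊗ V) ⊗ (U ⊗ V) -> (U ⊗ U) ⊗ (V ⊗ V) :=
  tassoc \o tmap idfun (tassocV \o tmap twist idfun \o tassoc) \o tassocV.

HB.instance Definition _ := GRing.Linear.on tswap.

Lemma tswapE u v u' v' :
  tswap ((u ⊗ₜ v) ⊗ₜ (u' ⊗ₜ v')) = (u ⊗ₜ u') ⊗ₜ (v ⊗ₜ v').
Proof.
by rewrite /tswap /= tassocVE tmapE /= tassocE tmapE /= twistE tassocVE tassocE.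
Qed.

Definition tmul (muU : {linear U ⊗ U -> U}) (muV : {linear V ⊗ V -> V}) :
  (U ⊗ V) ⊗ (U ⊗ V) -> U ⊗ V := tmap muU muV \o tswap.

HB.instance Definition _ muU muV := GRing.Linear.on (tmul muU muV).

Lemma tmulE muU muV u v u' v' :
  tmul muU muV ((u ⊗ₜ v) ⊗ₜ (u' ⊗ₜ v')) = muU (u ⊗ₜ u') ⊗ₜ muV (v ⊗ₜ v').
Proof. by rewrite -[LHS]/(tmap muU muV (tswap _)) tswapE tmapE. Qed.

End TensorAlgebra.

Arguments tswap {K U V}.
Arguments tmul {K U V} muU muV.

Section HomStructures.
Variables (K : comNzRingType) (H : lmodType K).
Implicit Types (mu : {linear H ⊗ H -> H}) (Delta : {linear H -> H ⊗ H}).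
Implicit Types (alpha : {linear H -> H}) (c : H) (R : H ⊗ H).

Record hom_associative_algebra mu alpha : Prop := HomAssociativeAlgebra {
  hom_mul_morph : alpha \o mu =1 mu \o tmap alpha alpha;
  hom_mulA : mu \o tmap alpha mu =1 mu \o tmap mu alpha \o tassoc
}.

Record hom_coassociative_coalgebra Delta alpha : Prop :=
  HomCoassociativeCoalgebra {
    hom_comul_morph : tmap alpha alpha \o Delta =1 Delta \o alpha;
    hom_comulA : tassoc \o tmap alpha Delta \o Delta
                 =1 tmap Delta alpha \o Delta
  }.

Record hom_bialgebra mu Delta alpha : Prop := HomBialgebra {
  hom_bialgebra_alg : hom_associative_algebra mu alpha;
  hom_bialgebra_coalg : hom_coassociative_coalgebra Delta alpha;
  hom_bialgebra_compat :
    Delta \o mu =1 tmap mu mu \o tswap \o tmap Delta Delta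
}.

Definition weak_unit mu alpha c : Prop :=
  forall x, alpha x = mu (c ⊗ₜ x) /\ alpha x = mu (x ⊗ₜ c).

Definition R12 c R : H ⊗ H ⊗ H := R ⊗ₜ c.
Definition R23 c R : H ⊗ H ⊗ H := tassoc (c ⊗ₜ R).
Definition R13 c R : H ⊗ H ⊗ H := tmap twist idfun (R23 c R).

Definition mul2 mu (s t : H ⊗ H) : H ⊗ H := tmul mu mu (s ⊗ₜ t).
Definition mul3 mu (s t : H ⊗ H ⊗ H) : H ⊗ H ⊗ H :=
  tmul (tmul mu mu) mu (s ⊗ₜ t).

Definition comul_op Delta : H -> H ⊗ H := twist \o Delta.

Record quasi_triangular_hom_bialgebra mu Delta alpha c R : Prop :=
  QuasiTriangularHomBialgebra {
    qt_hom_bialgebra : hom_bialgebra mu Delta alpha;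
    qt_weak_unit : weak_unit mu alpha c;
    qt_comul_l : tmap Delta alpha R = mul3 mu (R13 c R) (R23 c R);
    qt_comul_r : tassoc (tmap alpha Delta R) = mul3 mu (R13 c R) (R12 c R);
    qt_comul_op : forall x, mul2 mu (comul_op Delta x) R = mul2 mu R (Delta x)
  }.

End HomStructures.

(* The condition [pchar K] =i pred0 would be too weak: it also
   holds in Z/4. *)
Definition char_zero (K : comNzRingType) : Prop :=
  forall n : nat, n%:R = 0 :> K -> n = 0%N.

(* Main.v *)
Require Import Defs.
From mathcomp Require Import all_boot all_algebra.

Set Implicit Arguments.
Unset Strict Implicit.
Unset Printing Implicit Defensive.

Import GRing.Theory.

Local Open Scope ring_scope.

(** The proof is Yau's twisting principle, applied to the endomorphism alpha.

    Let beta be an endomorphism of the Hom-bialgebra H: it commutes with mu,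
    Delta and alpha. Replacing (mu, Delta, alpha) by
    (beta o mu, Delta o beta, beta o alpha) composes both sides of every
    axiom with one and the same power of beta, since beta can be moved through
    all the structure maps; R and c stay as they are
    ([quasi_triangular_twist]). By its multiplicativity and
    comultiplicativity, alpha is an endomorphism, hence so are its iterates
    ([hom_bialgebra_endo_iter]). Part (1) is the case beta = alpha^(2^n - 1),
    for which beta o alpha = alpha^(2^n).

    For part (2), beta = alpha^k is also applied to R itself
    ([quasi_triangular_endo]). The obstacle is that beta need not fix c,
    which occurs in R_12, R_13 and R_23. In the two products of the axioms,
    however, c only occurs multiplied by a leg of R, and it then acts as
    alpha: with R = sum s_i (x) t_i,
      R_13 R_23 = sum alpha(s_i) (x) alpha(s_j) (x) t_i t_j,
      R_13 R_12 = sum s_i s_j (x) alpha(t_j) (x) alpha(t_i).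
    These forms do not mention c ([mul_R13_R23], [mul_R13_R12]), so beta
    carries them to the same products for (beta (x) beta)(R). The remaining
    axiom Delta^op(x) R = R Delta(x) is obtained in this way only for x in the
    image of beta, and this is where surjectivity enters. Twisting the
    result by alpha^(2^n - 1) as before gives part (2). *)

(** * Functoriality of the tensor operations *)

Lemma eq_tmap (K : comNzRingType) (U U' V V' : lmodType K)
    (f f' : {linear U -> U'}) (g g' : {linear V -> V'}) :
  f =1 f' -> g =1 g' -> tmap f g =1 tmap f' g'.
Proof.
by move=> eq_f eq_g; apply: eq_tensor => u v; rewrite !tmapE eq_f eq_g.
Qed.

Lemma tmap_id (K : comNzRingType) (U V : lmodType K)
    (f : {linear U -> U}) (g : {linear V -> V}) :
  f =1 id -> g =1 id -> tmap f g =1 id.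
Proof.
move=> f_id g_id; apply: (eq_tensor (g := idfun)) => u v.
by rewrite tmapE f_id g_id.
Qed.

Lemma tmap_comp (K : comNzRingType) (U U' U'' V V' V'' : lmodType K)
    (f' : {linear U' -> U''}) (f : {linear U -> U'})
    (g' : {linear V' -> V''}) (g : {linear V -> V'}) t :
  tmap (f' \o f) (g' \o g) t = tmap f' g' (tmap f g t).
Proof.
apply: (eq_tensor (f := tmap (f' \o f) (g' \o g))
  (g := tmap f' g' \o tmap f g)) => u v.
by rewrite /= !tmapE.
Qed.

Lemma twist_tmap (K : comNzRingType) (U U' V V' : lmodType K)
    (f : {linear U -> U'}) (g : {linear V -> V'}) t :
  twist (tmap f g t) = tmap g f (twist t).
Proof.
apply: (eq_tensor (f := twist \o tmap f g) (g := tmap g f \o twist)) => u v.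
by rewrite /= tmapE !twistE tmapE.
Qed.

(** The extensionality principle behind all computations with a product of two
    tensors: it suffices to multiply pure tensors. *)
Lemma eq_tensor2 (K : comNzRingType) (U V U' V' W : lmodType K)
    (f g : {linear (U ⊗ V) ⊗ (U' ⊗ V') -> W}) :
  (forall u v u' v',
     f ((u ⊗ₜ v) ⊗ₜ (u' ⊗ₜ v')) = g ((u ⊗ₜ v) ⊗ₜ (u' ⊗ₜ v'))) ->
  f =1 g.
Proof.
move=> fg; apply: eq_tensor => s t.
elim/tensor_ind: s => [|u v|s s' IHs IHs'|a s IHs].
- by rewrite linear0l !linear0.
- elim/tensor_ind: t => [|u' v'|t t' IHt IHt'|a t IHt].
  + by rewrite linear0r !linear0.
  + exact: fg.
  + by rewrite linearDr !linearD IHt IHt'.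
  + by rewrite linearZr /= !linearZ /= IHt.
- by rewrite linearDl !linearD IHs IHs'.
- by rewrite linearZl_LR /= !linearZ /= IHs.
Qed.

Lemma tassoc_tmap (K : comNzRingType) (U U' V V' W W' : lmodType K)
    (f : {linear U -> U'}) (g : {linear V -> V'}) (h : {linear W -> W'}) t :
  tassoc (tmap f (tmap g h) t) = tmap (tmap f g) h (tassoc t).
Proof.
apply: (eq_tensor (f := tassoc \o tmap f (tmap g h))
  (g := tmap (tmap f g) h \o tassoc)) => u s /=; rewrite tmapE.
elim/tensor_ind: s => [|v w|s s' IHs IHs'|a s IHs].
- by rewrite !(linear0, linear0r).
- by rewrite !(tmapE, tassocE).
- by rewrite !(linearD, linearDr) /= IHs IHs'.
- by rewrite linearZ /= !linearZr /= !linearZ /= IHs.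
Qed.


Lemma tswap_tmap (K : comNzRingType) (U U' V V' : lmodType K)
    (f : {linear U -> U'}) (g : {linear V -> V'}) t :
  tswap (tmap (tmap f g) (tmap f g) t) = tmap (tmap f f) (tmap g g) (tswap t).
Proof.
apply: (eq_tensor2 (f := tswap \o tmap (tmap f g) (tmap f g))
  (g := tmap (tmap f f) (tmap g g) \o tswap)) => u v u' v' /=.
by rewrite !(tmapE, tswapE).
Qed.

Lemma tmul_comp (K : comNzRingType) (U V : lmodType K)
    (f : {linear U -> U}) (g : {linear V -> V})
    (muU : {linear U ⊗ U -> U}) (muV : {linear V ⊗ V -> V}) t :
  tmul (f \o muU) (g \o muV) t = tmap f g (tmul muU muV t).
Proof. exact: tmap_comp. Qed.

(** * Products of the three embeddings of R *)

Section Products.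
Variables (K : comNzRingType) (H : lmodType K) (mu : {linear H ⊗ H -> H}).
Variables (alpha : {linear H -> H}) (c : H).
Hypothesis unit_c : weak_unit mu alpha c.

Lemma mul3_comp (beta : {linear H -> H}) s t :
  mul3 (beta \o mu) s t = tmap (tmap beta beta) beta (mul3 mu s t).
Proof.
rewrite /mul3 -tmul_comp /tmul /=.
by apply: eq_tmap => // u; apply: tmul_comp.
Qed.

(** On pure tensors R = s (x) t and S = s' (x) t' the product is
    sc (x) cs' (x) tt', and c acts as alpha on either side. The result does not
    depend on c, so that it is natural for maps that move c. The two tensors
    are kept distinct because the expression is linear in each of them
    separately but quadratic in R = S. *)
Lemma mul_R13_R23 R S :
  mul3 mu (R13 c R) (R23 c S)
  = tmap (tmap alpha alpha) mu (tswap (R ⊗ₜ S)).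
Proof.
pose r23 : {linear H ⊗ H -> _} := tassoc \o tens c.
pose r13 : {linear H ⊗ H -> _} := tmap twist idfun \o r23.
have -> : mul3 mu (R13 c R) (R23 c S)
    = (tmul (tmul mu mu) mu \o tmap r13 r23) (R ⊗ₜ S).
  by rewrite /= tmapE.
apply: (eq_tensor2 (g := tmap (tmap alpha alpha) mu \o tswap)) => s t s' t' /=.
rewrite tswapE !tmapE /= !tassocE tmapE twistE tmulE /= tmulE.
by rewrite -(unit_c s).2 -(unit_c s').1.
Qed.

(** On pure tensors the product is ss' (x) ct' (x) tc: the second legs come out
    in reverse order, whence the twist. *)
Lemma mul_R13_R12 R S :
  mul3 mu (R13 c R) (R12 c S)
  = tassoc (tmap mu (tmap alpha alpha \o twist) (tswap (R ⊗ₜ S))).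
Proof.
pose r12 : {linear H ⊗ H -> _} := applyr tens c.
pose r13 : {linear H ⊗ H -> _} := tmap twist idfun \o tassoc \o tens c.
have -> : mul3 mu (R13 c R) (R12 c S)
    = (tmul (tmul mu mu) mu \o tmap r13 r12) (R ⊗ₜ S).
  by rewrite /= tmapE.
apply: (eq_tensor2
  (g := tassoc \o tmap mu (tmap alpha alpha \o twist) \o tswap)) => s t s' t' /=.
rewrite tswapE !tmapE /= !tassocE !tmapE /= !twistE tmapE tassocE tmulE /= tmulE.
by rewrite -(unit_c t).2 -(unit_c t').1.
Qed.

End Products.

(** * Twisting along an endomorphism *)

Section Endomorphism.
Variables (K : comNzRingType) (H : lmodType K).
Implicit Types (mu : {linear H ⊗ H -> H}) (Delta : {linear H -> H ⊗ H}).
Implicit Types (alpha beta : {linear H -> H}) (c : H) (R : H ⊗ H).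

(** Endomorphisms are not asked to preserve the weak unit: alpha maps c to cc,
    in general different from c, and alpha has to be one of them. *)
Record hom_bialgebra_endo mu Delta alpha beta : Prop := HomBialgebraEndo {
  endo_mul : forall t, beta (mu t) = mu (tmap beta beta t);
  endo_comul : forall x, tmap beta beta (Delta x) = Delta (beta x);
  endo_comm : forall x, beta (alpha x) = alpha (beta x)
}.

Lemma hom_bialgebra_endo_iter mu Delta alpha n :
  hom_bialgebra mu Delta alpha ->
  hom_bialgebra_endo mu Delta alpha (iter n alpha).
Proof.
case=> -[alpha_mu _] [alpha_Delta _] _.
elim: n => [|n [IHmul IHcomul IHcomm]]; split=> //=.
- by move=> t; rewrite tmap_id.
- by move=> x; rewrite tmap_id.
- move=> t; rewrite IHmul [LHS]alpha_mu /=; congr (mu _).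
  by rewrite -tmap_comp; apply: eq_tmap.
- move=> x; rewrite -[RHS]alpha_Delta /= -IHcomul -tmap_comp.
  exact: eq_tmap.
- by move=> x; rewrite IHcomm.
Qed.

Section Twist.
Variables (mu : {linear H ⊗ H -> H}) (Delta : {linear H -> H ⊗ H}).
(* alpha' is a variable rather than beta \o alpha, so that it may be an iterate
   of alpha carrying its own linear structure. *)
Variables (alpha beta alpha' : {linear H -> H}).
Hypothesis endo_beta : hom_bialgebra_endo mu Delta alpha beta.
Hypothesis alpha'E : alpha' =1 beta \o alpha.

Lemma comm_alpha' x : alpha' x = alpha (beta x).
Proof. by rewrite alpha'E /= (endo_comm endo_beta). Qed.

(** Both sides of Hom-associativity acquire beta twice, once from each
    multiplication; in the proof the outer one is cancelled and the inner one
    is moved into the arguments. *)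
Lemma hom_associative_algebra_twist :
  hom_associative_algebra mu alpha ->
  hom_associative_algebra (beta \o mu) alpha'.
Proof.
have [beta_mu _ _] := endo_beta.
case=> alpha_mu muA; split=> t /=.
  rewrite alpha'E /= -(endo_comm endo_beta); congr (beta _).
  rewrite [alpha _]alpha_mu /= beta_mu -tmap_comp; congr (mu _).
  by apply: eq_tmap => x; rewrite alpha'E.
congr (beta _); transitivity (beta (mu (tmap alpha mu t))).
  by rewrite beta_mu -tmap_comp; congr (mu _); apply: eq_tmap.
rewrite [mu _]muA /= beta_mu -tmap_comp; congr (mu _).
by apply: eq_tmap => // x; rewrite alpha'E.
Qed.

(** Dually, beta^2 is moved to the argument of the iterated
    comultiplication. *)
Lemma hom_coassociative_coalgebra_twist :
  hom_coassociative_coalgebra Delta alpha ->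
  hom_coassociative_coalgebra (Delta \o beta) alpha'.
Proof.
have [_ beta_Delta _] := endo_beta.
case=> alpha_Delta DeltaA; split=> x /=.
  rewrite (eq_tmap alpha'E alpha'E) tmap_comp [tmap alpha alpha _]alpha_Delta /=.
  by rewrite beta_Delta comm_alpha'.
transitivity (tassoc (tmap alpha Delta (Delta (beta (beta x))))).
  rewrite -beta_Delta -tmap_comp; congr (tassoc _).
  by apply: eq_tmap => // y; rewrite comm_alpha'.
rewrite [LHS]DeltaA /= -beta_Delta -tmap_comp.
by apply: eq_tmap => // y; rewrite comm_alpha'.
Qed.

Lemma hom_bialgebra_twist :
  hom_bialgebra mu Delta alpha ->
  hom_bialgebra (beta \o mu) (Delta \o beta) alpha'.
Proof.
have [beta_mu beta_Delta _] := endo_beta.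
case=> alg coalg compat; split.
- exact: hom_associative_algebra_twist.
- exact: hom_coassociative_coalgebra_twist.
move=> t /=; rewrite !tmap_comp -[tmap mu mu _]compat /=.
by rewrite beta_Delta -beta_mu.
Qed.

(** The weak unit survives because (beta o mu)(c, x) = beta (alpha x). In the
    two axioms on R, the comultiplied side is (beta (x) beta (x) beta) of the
    original one since Delta o beta = (beta (x) beta) o Delta, and so is the
    product side by [mul3_comp]. In the last axiom for x, beta is applied to
    the original axiom for beta x. *)
Lemma quasi_triangular_twist c R :
  quasi_triangular_hom_bialgebra mu Delta alpha c R ->
  quasi_triangular_hom_bialgebra (beta \o mu) (Delta \o beta) alpha' c R.
Proof.
have [beta_mu beta_Delta _] := endo_beta.
case=> bialg unit_c comul_l comul_r comul_opR; split.
- exact: hom_bialgebra_twist.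
- by move=> x; rewrite alpha'E /= -(unit_c x).1 -(unit_c x).2.
- rewrite mul3_comp -comul_l -tmap_comp; apply: eq_tmap => x.
    by rewrite /= beta_Delta.
  exact: alpha'E.
- rewrite mul3_comp -comul_r -tassoc_tmap -tmap_comp; congr (tassoc _).
  by apply: eq_tmap => x; rewrite /= ?alpha'E ?beta_Delta.
- move=> x; rewrite /mul2 !tmul_comp; congr (tmap _ _ _).
  exact: comul_opR.
Qed.

End Twist.

(** The first two axioms for (beta (x) beta)(R) are the images of those for R
    under beta (x) beta (x) beta, since the forms of the products free of c are
    natural in R. The last one, at a point beta x, is the image of the one for
    R at x; surjectivity makes every point such. *)
Lemma quasi_triangular_endo mu Delta alpha c R beta :
  hom_bialgebra_endo mu Delta alpha beta ->
  (forall y, exists x, beta x = y) ->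
  quasi_triangular_hom_bialgebra mu Delta alpha c R ->
  quasi_triangular_hom_bialgebra mu Delta alpha c (tmap beta beta R).
Proof.
case=> beta_mu beta_Delta beta_alpha beta_surj.
case=> bialg unit_c comul_l comul_r comul_opR.
have beta_alpha2 s : tmap beta beta (tmap alpha alpha s)
    = tmap alpha alpha (tmap beta beta s).
  by rewrite -!tmap_comp; apply: eq_tmap.
split=> //.
- rewrite (mul_R13_R23 unit_c) in comul_l; rewrite (mul_R13_R23 unit_c).
  rewrite -(tmapE (tmap beta beta) (tmap beta beta)) tswap_tmap.
  transitivity (tmap (tmap beta beta) beta (tmap Delta alpha R)).
    rewrite -!tmap_comp.
    by apply: eq_tmap => x /=; rewrite ?beta_Delta ?beta_alpha.
  rewrite comul_l -!tmap_comp.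
  by apply: eq_tmap => s //=; rewrite ?beta_alpha2 ?beta_mu.
- rewrite (mul_R13_R12 unit_c) in comul_r; rewrite (mul_R13_R12 unit_c).
  rewrite -(tmapE (tmap beta beta) (tmap beta beta)) tswap_tmap.
  transitivity (tmap (tmap beta beta) beta (tassoc (tmap alpha Delta R))).
    rewrite -tassoc_tmap -!tmap_comp; congr (tassoc _).
    by apply: eq_tmap => x /=; rewrite ?beta_Delta ?beta_alpha.
  rewrite comul_r -tassoc_tmap -!tmap_comp; congr (tassoc _).
  by apply: eq_tmap => s //=; rewrite ?beta_alpha2 ?beta_mu ?twist_tmap.
- move=> y; have [x <-] := beta_surj y.
  rewrite /comul_op /= -beta_Delta twist_tmap.
  have mul2_beta s t : mul2 mu (tmap beta beta s) (tmap beta beta t)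
      = tmap beta beta (mul2 mu s t).
    rewrite /mul2 -tmapE /tmul /= tswap_tmap -!tmap_comp.
    by apply: eq_tmap => u /=; rewrite beta_mu.
  by rewrite !mul2_beta [mul2 _ _ _]comul_opR.
Qed.

End Endomorphism.

Lemma iter_surj (T : Type) (f : T -> T) k :
  (forall y, exists x, f x = y) -> forall y, exists x, iter k f x = y.
Proof.
move=> f_surj; elim: k => [|k IHk] y; first by exists y.
by have [x <-] := f_surj y; have [z <-] := IHk x; exists z.
Qed.

Theorem theorem3p4 (K : comNzRingType) (charK : char_zero K) (H : lmodType K)
    (mu : {linear H ⊗ H -> H}) (Delta : {linear H -> H ⊗ H})
    (alpha : {linear H -> H}) (c : H) (R : H ⊗ H)
    (qtH : quasi_triangular_hom_bialgebra mu Delta alpha c R) :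
  (forall n : nat,
     quasi_triangular_hom_bialgebra
       (iter (2 ^ n - 1) alpha \o mu) (Delta \o iter (2 ^ n - 1) alpha)
       (iter (2 ^ n) alpha) c R)
  /\ ((forall y : H, exists x : H, alpha x = y) ->
      forall n k : nat,
        quasi_triangular_hom_bialgebra
          (iter (2 ^ n - 1) alpha \o mu) (Delta \o iter (2 ^ n - 1) alpha)
          (iter (2 ^ n) alpha) c
          (tmap (iter k alpha) (iter k alpha) R)).
Proof.
have endo_iter k : hom_bialgebra_endo mu Delta alpha (iter k alpha).
  exact: hom_bialgebra_endo_iter (qt_hom_bialgebra qtH).
have iter_pow n : iter (2 ^ n) alpha =1 iter (2 ^ n - 1) alpha \o alpha.
  by move=> x; rewrite /= -iterSr subn1 prednK ?expn_gt0.
have twist_iter n c' R' :=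
  @quasi_triangular_twist _ _ _ _ _ _ _ (endo_iter _) (iter_pow n) c' R'.
split=> [n | alpha_surj n k]; refine (twist_iter n _ _ _); first exact: qtH.
exact: quasi_triangular_endo (endo_iter k) (iter_surj k alpha_surj) qtH.
Qed.
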